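(* Let $r\geq 1$, let $\phi:A\to K\{\tau\}$ be a Drinfeld module of rank $r$ with $A=\mathbb{F}_q[T]$, let $g_r\in K$ be the leading coefficient of $\phi_T$ (the coefficient of $\tau^r$), and let $\psi:A\to K\{\tau\}$ be the rank $1$ Drinfeld module determined by $\psi_T=\gamma(T)+(-1)^{r-1}g_r\tau$. For monic $c\in A$ of degree $\geq 1$ let $W_c:\overline{K}^r\to\overline{K}$ be the map defined in the context. Let $a,b\in A$ be monic polynomials of degree $\geq 1$. Then for all $\beta_1,\ldots,\beta_r\in\phi[ab]$, $$\psi_b\big(W_{ab}(\beta_1,\ldots,\beta_r)\big)=W_a\big(\phi_b(\beta_1),\ldots,\phi_b(\beta_r)\big).$$
   Context: Let $q$ be a prime power, $A=\mathbb{F}_q[T]$, $K$ a field containing $\mathbb{F}_q$ and equipped with an $\mathbb{F}_q$-algebra homomorphism $\gamma:A\to K$. Let $\overline{K}$ be an algebraic closure of $K$, $\tau:\overline{K}\to\overline{K}$, $\alpha\mapsto\alpha^q$, and $K\{\tau\}$ the noncommutative ring of polynomials in $\tau$ with coefficients in $K$ and commutation rule $\tau\alpha=\alpha^q\tau$ for $\alpha \in K$. An element $\sum_i c_i\tau^i\in K\{\tau\}$ acts on $\overline{K}$ by $\beta\mapsto\sum_i c_i\beta^{q^i}$. A Drinfeld module of rank $r\geq 1$ is an $\mathbb{F}_q$-algebra homomorphism $\phi:A\to K\{\tau\}$, $a\mapsto\phi_a$, such that for nonzero $a$ one has $\phi_a=\gamma(a)+\sum_{i=1}^{r\deg(a)}g_i(a)\tau^i$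 with $g_{r\deg(a)}(a)\neq 0$. For $a\in A$, $\phi[a]=\{\beta\in\overline{K}:\phi_a(\beta)=0\}$. Polynomials $f_a$: for a monic $a\in\overline{\mathbb{F}}_q[T]$ of degree $n\geq 1$, factored as $a=(T-\alpha_1)\cdots(T-\alpha_n)$ with $\alpha_i\in\overline{\mathbb{F}}_q$ not necessarily distinct, define $$f_a(T_1,\ldots,T_r)=\sum_{1=i_0\leq i_1\leq\cdots\leq i_r=n}\ \prod_{j=1}^r\ \prod_{\substack{1\leq i\leq n\\ i\notin[i_{j-1},i_j]}}(T_j-\alpha_i)\in\overline{\mathbb{F}}_q[T_1,\ldots,T_r],$$ the sum being over integer tuples $(i_0,\ldots,i_r)$. It does not depend on the ordering of the roots, and if $a\in A$ then $f_a\in\mathbb{F}_q[T_1,\ldots,T_r]$. Moore determinant: $M(x_1,\ldots,x_r)=\det\big(x_i^{q^{j-1}}\big)_{1\leq i,j\leq r}$. Map $W_a$: for monic $a\in A$ of degree $n\geq 1$, write $f_a=\sum_{\mathbf{i}=(i_1,\ldots,i_r),\,0\leq i_1,\ldots,i_r\leq n-1}a_{\mathbf{i}}T_1^{i_1}\cdots T_r^{i_r}$ with $a_{\mathbf{i}}\in\mathbb{F}_q$, and set $$W_a(\beta_1,\ldots,\beta_r)=\sum_{\mathbf{i}}a_{\mathbf{i}}\,M\big(\phi_{T^{i_1}}(\beta_1),\ldots,\phi_{T^{i_r}}(\beta_r)\big),\qquad \beta_1,\ldots,\beta_r\in\overline{K}.$$ *)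

(* Defs.v *)
From HB Require Import structures.
From mathcomp Require Import all_boot all_order all_algebra all_field.
From mathcomp Require Import mpoly.

Set Implicit Arguments.
Unset Strict Implicit.
Unset Printing Implicit Defensive.

Import GRing.Theory.
Local Open Scope ring_scope.

(* The skew polynomial ring R{t; s}, with t * c = s(c) * t. The coefficient
   sequence c_0, c_1, ... of \sum_i c_i t^i is stored in a {poly R}; only the
   multiplication differs from that of {poly R}. *)
Definition skewpoly (R : nzRingType) (s : {rmorphism R -> R}) : Type := {poly R}.

Section SkewPoly.
Variables (R : nzRingType) (s : {rmorphism R -> R}).
Implicit Types p q : {poly R}.

HB.instance Definition _ := GRing.Zmodule.copy (skewpoly s) {poly R}.

Definition skewcoef (p : skewpoly s) (i : nat) : R := (p : {poly R})`_i.

(* As for {poly R}, the size is the degree in t plus one, and 0 for p = 0. *)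
Definition skewsize (p : skewpoly s) : nat := size (p : {poly R}).

Definition skewC (c : R) : skewpoly s := c%:P.

Definition skewX : skewpoly s := 'X.

Definition skewmul p q : {poly R} :=
  \poly_(k < size p + size q) \sum_(i < k.+1) p`_i * iter i s q`_(k - i).

Lemma iter_rmorph0 i : iter i s 0 = 0.
Proof. by elim: i => //= i ->; rewrite rmorph0. Qed.

Lemma iter_rmorph1 i : iter i s 1 = 1.
Proof. by elim: i => //= i ->; rewrite rmorph1. Qed.

Lemma iter_rmorphD i : {morph iter i s : x y / x + y}.
Proof. by elim: i => // i IHi x y; rewrite !iterS IHi rmorphD. Qed.

Lemma iter_rmorphM i : {morph iter i s : x y / x * y}.
Proof. by elim: i => // i IHi x y; rewrite !iterS IHi rmorphM. Qed.

Lemma coef_skewmul p q k :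
  (skewmul p q)`_k = \sum_(i < k.+1) p`_i * iter i s q`_(k - i).
Proof.
rewrite coef_poly; case: ltnP => // le_pq_k; rewrite big1 // => i _.
have [lt_i|le_i] := ltnP i (size p); last by rewrite nth_default ?mul0r.
rewrite [q`__]nth_default ?iter_rmorph0 ?mulr0 //.
have le_ik : (i <= k)%N by rewrite -ltnS.
by rewrite leq_subRL // (leq_trans _ le_pq_k) // leq_add2r ltnW.
Qed.

Lemma coef_skewmul_rev p q k :
  (skewmul p q)`_k = \sum_(i < k.+1) p`_(k - i) * iter (k - i) s q`_i.
Proof.
rewrite coef_skewmul (reindex_inj rev_ord_inj) /=.
by apply: eq_bigr => i _; rewrite subKn // -ltnS.
Qed.

Lemma skewmulA : associative skewmul.
Proof.
move=> p q r; apply/polyP=> i; rewrite coef_skewmul coef_skewmul_rev.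
pose coef3 j k := p`_j * (iter j s q`_(i - j - k) * iter (i - k) s r`_k).
transitivity (\sum_(j < i.+1) \sum_(k < i.+1 | (k <= i - j)%N) coef3 j k).
  apply: eq_bigr => /= j _; rewrite coef_skewmul_rev.
  rewrite (big_morph _ (iter_rmorphD j) (iter_rmorph0 j)) big_distrr /=.
  rewrite (big_ord_narrow_leq (leq_subr _ _)); apply: eq_bigr => /= k _.
  rewrite iter_rmorphM -iterD /coef3; congr (_ * (_ * iter _ s _)).
  have lej : (j <= i)%N by rewrite -ltnS.
  by rewrite addnBA ?subnKC // -ltnS.
rewrite (exchange_big_dep predT) //=; apply: eq_bigr => k _.
transitivity (\sum_(j < i.+1 | (j <= i - k)%N) coef3 j k).
  apply: eq_bigl => j; rewrite -ltnS -(ltnS j) -!subSn ?leq_ord //.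
  by rewrite -subn_gt0 -(subn_gt0 j) -!subnDA addnC.
rewrite (big_ord_narrow_leq (leq_subr _ _)) coef_skewmul big_distrl /=.
by apply: eq_bigr => j _; rewrite /coef3 -!subnDA addnC mulrA.
Qed.

Lemma skewmul1l : left_id 1%:P skewmul.
Proof.
move=> p; apply/polyP=> k; rewrite coef_skewmul big_ord_recl subn0.
by rewrite coefC mul1r big1 ?addr0 // => j _; rewrite coefC mul0r.
Qed.

Lemma skewmul1r : right_id 1%:P skewmul.
Proof.
move=> p; apply/polyP=> k; rewrite coef_skewmul_rev big_ord_recl subn0.
rewrite coefC iter_rmorph1 mulr1 big1 ?addr0 // => j _.
by rewrite coefC iter_rmorph0 mulr0.
Qed.

Lemma skewmulDl : left_distributive skewmul +%R.
Proof.
move=> p q r; apply/polyP=> k; rewrite coefD !coef_skewmul -big_split.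
by apply: eq_bigr => i _; rewrite coefD mulrDl.
Qed.

Lemma skewmulDr : right_distributive skewmul +%R.
Proof.
move=> p q r; apply/polyP=> k; rewrite coefD !coef_skewmul -big_split.
by apply: eq_bigr => i _; rewrite coefD iter_rmorphD mulrDr.
Qed.

HB.instance Definition _ :=
  GRing.Zmodule_isNzRing.Build (skewpoly s)
    skewmulA skewmul1l skewmul1r skewmulDl skewmulDr (oner_neq0 {poly R}).

Lemma skewX_comm c : skewX * skewC c = skewC (s c) * skewX.
Proof.
apply/polyP=> k; rewrite [LHS]coef_skewmul [RHS]coef_skewmul /skewX /skewC.
case: k => [|k].
  by rewrite !big_ord_recl !big_ord0 /= !coefX !coefC /= mul0r mulr0.
rewrite big_ord_recl [in LHS]big_ord_recl [RHS]big_ord_recl.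
rewrite [X in _ + (_ + X)]big1 => [|i _]; last by rewrite coefX mul0r.
rewrite [X in _ = _ + X]big1 => [|i _]; last by rewrite coefC mul0r.
rewrite !addr0 !coefX !coefC /= mul0r add0r mul1r subSS subn0.
by case: k => [|k] /=; rewrite ?mulr1 // rmorph0 mulr0.
Qed.

End SkewPoly.

(* The q-power endomorphism of a field K containing F_q, where q = #|Fq|. *)
Definition frob (Fq : finFieldType) (K : fieldType) (iota : {rmorphism Fq -> K})
  (x : K) : K := x ^+ #|Fq|.

Section Frobenius.
Variables (Fq : finFieldType) (K : fieldType) (iota : {rmorphism Fq -> K}).

Lemma pchar_nat_card : [pchar K].-nat #|Fq|.
Proof.
have [p _ pcharFp] := finPcharP Fq.
have pcharKp : p \in [pchar K] := rmorph_pchar iota pcharFp.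
rewrite (eq_pnat _ (pcharf_eq pcharKp)) (card_pprimeChar pcharFp).
by rewrite pnatX pnat_id ?(pcharf_prime pcharFp).
Qed.

Lemma frob_is_zmod_morphism : zmod_morphism (frob iota).
Proof.
move=> x y; rewrite /frob; apply/eqP; rewrite eq_sym subr_eq.
by rewrite -(exprDn_pchar _ _ pchar_nat_card) subrK.
Qed.

Lemma frob_is_monoid_morphism : monoid_morphism (frob iota).
Proof. by split=> [|x y]; rewrite /frob ?expr1n ?exprMn. Qed.

HB.instance Definition _ :=
  GRing.isZmodMorphism.Build K K (frob iota) frob_is_zmod_morphism.
HB.instance Definition _ :=
  GRing.isMonoidMorphism.Build K K (frob iota) frob_is_monoid_morphism.

End Frobenius.

(* K{tau}, where K contains F_q through iota. *)
Notation twpoly iota := (skewpoly (frob iota)).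

Section Drinfeld.
Variables (Fq : finFieldType) (K : fieldType) (iota : {rmorphism Fq -> K}).

(* For a != 0 the degree of a is (size a).-1, so the third clause says that
   phi_a has constant term gamma(a), nonzero coefficient in degree r * deg(a),
   and no coefficient beyond. *)
Definition drinfeld_module (gamma : {rmorphism {poly Fq} -> K}) (r : nat)
    (phi : {rmorphism {poly Fq} -> twpoly iota}) : Prop :=
  [/\ (1 <= r)%N,
      forall c : Fq, phi c%:P = skewC (frob iota) (iota c)
    & forall a : {poly Fq}, a != 0 ->
        skewcoef (phi a) 0 = gamma a /\
        skewsize (phi a) = (r * (size a).-1).+1].

Variables (L : fieldType) (emb : {rmorphism K -> L}).

(* The action of K{tau} on an extension L of K. *)
Definition twact (p : twpoly iota) (x : L) : L :=
  \sum_(i < skewsize p) emb (skewcoef p i) * x ^+ (#|Fq| ^ i).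

Definition torsion (phi : {poly Fq} -> twpoly iota) (a : {poly Fq}) : {pred L} :=
  [pred x | twact (phi a) x == 0].

End Drinfeld.

(* E, with the embedding emb of F, is an algebraic closure of F. *)
Definition algebraic_closure (F : fieldType) (E : closedFieldType)
  (emb : {rmorphism F -> E}) : Prop := forall x : E, algebraicOver emb x.

Definition moore (q : nat) (L : fieldType) (r : nat) (x : 'I_r -> L) : L :=
  \det (\matrix_(i < r, j < r) x i ^+ (q ^ j)).

(* The sum defining f_a, for the roots alpha_1, ..., alpha_n. Root indices are
   shifted to 0, ..., n - 1, and so are the values of the tuples
   (i_0, ..., i_r); T_j for 1 <= j <= r is 'X_(j - 1). For j : 'I_r the interval
   attached to 'X_j is [i_j, i_(j+1)]. *)
Definition fsum (E : fieldType) (n r : nat) (alpha : n.-tuple E) : {mpoly E[r]} :=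
  \sum_(i : {ffun 'I_r.+1 -> 'I_n} |
      [&& i ord0 == 0%N :> nat, i ord_max == n.-1 :> nat
        & [forall j : 'I_r, (i (widen_ord (leqnSn r) j) <= i (lift ord0 j))%N]])
    \prod_(j < r)
      \prod_(k < n | ~~ (i (widen_ord (leqnSn r) j) <= k <= i (lift ord0 j))%N)
        ('X_j - (tnth alpha k)%:MP).

(* f_a for a monic over an algebraically closed field, the roots being listed
   with multiplicity; f_a does not depend on the order in which they are. *)
Definition fpoly (E : closedFieldType) (r : nat) (a : {poly E}) : {mpoly E[r]} :=
  fsum r (in_tuple (sval (closed_field_poly_normal a))).

Section Weil.
Variables (Fq : finFieldType) (Fqbar : closedFieldType).
Variables (jota : {rmorphism Fq -> Fqbar}).

(* For a over F_q, the coefficient in F_q of f_a at the monomial m, that is, the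
   element of F_q whose image in Fqbar is this coefficient of f_a. As f_a has all
   its coefficients in F_q, the default value 0 is not used. *)
Definition fcoef (r : nat) (a : {poly Fq}) (m : 'X_{1.. r}) : Fq :=
  odflt 0 [pick c | jota c == (fpoly r (map_poly jota a))@_m].

Variables (K : fieldType) (iota : {rmorphism Fq -> K}).
Variables (L : fieldType) (emb : {rmorphism K -> L}).

Definition weil (r : nat) (phi : {poly Fq} -> twpoly iota) (a : {poly Fq})
    (beta : 'I_r -> L) : L :=
  \sum_(i : {ffun 'I_r -> 'I_(size a).-1})
    emb (iota (fcoef a [multinom (i k : nat) | k < r])) *
    moore #|Fq| (fun k : 'I_r => twact emb (phi ('X^(i k))) (beta k)).

End Weil.

(* Main.v *)
Require Import Defs.
From HB Require Import structures.
From mathcomp Require Import all_boot all_order all_algebra all_field.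
From mathcomp Require Import mpoly ssrcomplements ring.

Set Implicit Arguments.
Unset Strict Implicit.
Unset Printing Implicit Defensive.

Import GRing.Theory.
Local Open Scope ring_scope.

(** Reading [T_k] as [phi_T] acting on the [k]-th argument turns
    [W_a(beta)] into [Lambda(f_a)], where [Lambda] is the linear functional on
    [F_q[T_1, ..., T_r]] sending a monomial [T^m] to the Moore determinant of
    the [phi_{T^{m_k}}(beta_k)]; it kills the ideal [(c(T_1), ..., c(T_r))] as
    soon as the [beta_k] are [c]-torsion.
    Dropping the monotonicity condition on the tuples in [f_a] only adds
    multiples of the [a(T_j)], and the unrestricted sum factors: modulo that
    ideal, [f_a] is the product over [j] of the divided differences
    [h_a(T_j, T_{j+1}) = (a(T_j) - a(T_{j+1})) / (T_j - T_{j+1})].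
    Being reduced, [f_a] is the normal form of this product, hence has its
    coefficients in [F_q].
    All [T_j] act alike on the product [H] of the [h_{ab}(T_j, T_{j+1})], and
    the cofactor expansion of the Moore determinant along its first column then
    gives [psi_T(Lambda(H)) = Lambda(T_1 H)], so
    [psi_b(W_{ab}(beta)) = Lambda(b(T_1) H)]. Finally
    [h_{ab}(x, y) = a(x) h_b(x, y) + b(y) h_a(x, y)] transforms [b(T_1) H] into
    the product of all [b(T_j)] and all [h_a(T_j, T_{j+1})]. *)

(** * Multilinear maps on families of polynomials and their linear extension *)

Section MultilinearExtension.
Variables (R S : comNzRingType) (f : {rmorphism R -> S}) (r : nat).
Implicit Types (mu : ('I_r.+1 -> {poly R}) -> S) (P Q : {mpoly R[r.+1]}).

Definition semilin (F : {mpoly R[r.+1]} -> S) :=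
  forall c P Q, F (c *: P + Q) = f c * F P + F Q.

(** Phrased through families that agree pointwise off [j], so that compatibility with [=1]
    ([multilin_ext]) follows without function extensionality. *)
Definition multilin mu :=
  forall p p1 p2 j c, p j = c *: p1 j + p2 j ->
    (forall i, i != j -> p i = p1 i) -> (forall i, i != j -> p i = p2 i) ->
  mu p = f c * mu p1 + mu p2.

(** The multivariate polynomial ring is the tensor power of the univariate one; this is the map that
    a multilinear [mu] induces on it. *)
Definition mext mu P : S :=
  \sum_(m <- msupp P) f P@_m * mu (fun k => 'X^(m k)).

Lemma semilin0 F : semilin F -> F 0 = 0.
Proof.
move=> linF; have := linF 1 0 0; rewrite scale1r addr0 rmorph1 mul1r.
by move/(congr1 (+%R^~ (- F 0))); rewrite addrK subrr.
Qed.

Lemma semilinD F P Q : semilin F -> F (P + Q) = F P + F Q.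
Proof. by move=> linF; have := linF 1 P Q; rewrite scale1r rmorph1 mul1r. Qed.

Lemma semilinB F P Q : semilin F -> F (P - Q) = F P - F Q.
Proof. by move=> linF; apply/eqP; rewrite eq_sym subr_eq -semilinD // subrK. Qed.

Lemma semilinZ F c P : semilin F -> F (c *: P) = f c * F P.
Proof. by move=> linF; rewrite -[c *: P]addr0 linF semilin0 // addr0. Qed.

Lemma semilin_sum F (I : Type) (s : seq I) (B : pred I) (G : I -> {mpoly R[r.+1]}) :
  semilin F -> F (\sum_(i <- s | B i) G i) = \sum_(i <- s | B i) F (G i).
Proof.
move=> linF; apply: (big_morph F) => [P Q|]; last exact: semilin0.
exact: semilinD.
Qed.

Lemma eq_semilin F G : semilin F -> semilin G ->
  (forall m, F 'X_[m] = G 'X_[m]) -> F =1 G.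
Proof.
move=> linF linG eqFG; elim/mpolyind => [|c m P _ _ IH].
  by rewrite !semilin0.
by rewrite linF linG eqFG IH.
Qed.

Lemma semilinM F P : semilin F -> semilin (fun Q => F (P * Q)).
Proof. by move=> linF c Q1 Q2; rewrite mulrDr -scalerAr linF. Qed.

Lemma semilin_suml (I : finType) (G : I -> {mpoly R[r.+1]} -> S) :
  (forall i, semilin (G i)) -> semilin (fun P => \sum_i G i P).
Proof.
move=> linG c P Q; rewrite mulr_sumr -big_split /=.
by apply: eq_bigr => i _; rewrite linG.
Qed.

Lemma mextE mu P d : (msize P <= d)%N ->
  mext mu P = \sum_(m : 'X_{1..r.+1 < d}) f P@_m * mu (fun k => 'X^(m k)).
Proof.
move=> le_Pd; rewrite /mext (big_mksub 'X_{1..r.+1 < d}) ?msupp_uniq //=; last first.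
  by move=> x /msize_mdeg_lt /leq_trans; apply.
by rewrite big_rmcond //= => j /memN_msupp_eq0 ->; rewrite rmorph0 mul0r.
Qed.

Lemma mext_semilin mu : semilin (mext mu).
Proof.
move=> c P Q; set d := maxn (msize (c *: P + Q)) (maxn (msize P) (msize Q)).
rewrite (@mextE mu _ d) ?leq_maxl // (@mextE mu P d); last first.
  by rewrite !leq_max leqnn orbT.
rewrite (@mextE mu Q d); last by rewrite !leq_max leqnn !orbT.
rewrite mulr_sumr -big_split; apply: eq_bigr => m _ /=.
by rewrite mcoeffD mcoeffZ rmorphD rmorphM mulrDl mulrA.
Qed.

Lemma mextX mu m : mext mu 'X_[m] = mu (fun k => 'X^(m k)).
Proof. by rewrite /mext msuppX big_seq1 mcoeffX eqxx rmorph1 mul1r. Qed.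

Lemma multilin_ext mu p p' : multilin mu -> p =1 p' -> mu p = mu p'.
Proof.
move=> linmu eqp.
have -> := linmu p p p' ord0 0; first by rewrite rmorph0 mul0r add0r.
- by rewrite scale0r add0r eqp.
- by [].
- by move=> i _; rewrite eqp.
Qed.

Definition updf (p : 'I_r.+1 -> {poly R}) j (q : {poly R}) :=
  fun i => if i == j then q else p i.

Lemma updf_id p j q : updf p j q j = q.
Proof. by rewrite /updf eqxx. Qed.

Lemma updf_neq p j q i : i != j -> updf p j q i = p i.
Proof. by rewrite /updf => /negPf ->. Qed.

Lemma multilin_updf mu p j c q1 q2 : multilin mu ->
  mu (updf p j (c *: q1 + q2)) = f c * mu (updf p j q1) + mu (updf p j q2).
Proof.
by move=> linmu; apply: (linmu _ _ _ j); rewrite ?updf_id // => i ne;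
  rewrite !updf_neq.
Qed.

Lemma multilin_updf0 mu p j : multilin mu -> mu (updf p j 0) = 0.
Proof.
move=> linmu; have := multilin_updf p j 1 0 0 linmu.
rewrite scaler0 addr0 rmorph1 mul1r => /(congr1 (+%R^~ (- mu (updf p j 0)))).
by rewrite addrK subrr.
Qed.

Lemma eq_multilin mu nu : multilin mu -> multilin nu ->
    (forall m : 'I_r.+1 -> nat, mu (fun k => 'X^(m k)) = nu (fun k => 'X^(m k))) ->
  mu =1 nu.
Proof.
move=> linmu linnu eqX p.
(* Only the first [d] entries may fail to be powers of the variable; each induction step expands the
   last of these in monomials. *)
suff: forall d p, (forall k : 'I_r.+1, (d <= k)%N -> exists m, p k = 'X^m) ->
    mu p = nu p.
  by move/(_ r.+1 p); apply=> k; rewrite leqNgt ltn_ord.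
elim=> [|d IHd] {}p monp.
  have [m mE] : exists m : 'I_r.+1 -> nat, forall k, p k = 'X^(m k).
    have ex k : exists m, p k == 'X^m by have [m ->] := monp k isT; exists m.
    by exists (fun k => xchoose (ex k)) => k; apply/eqP/(xchooseP (ex k)).
  by rewrite (multilin_ext linmu mE) (multilin_ext linnu mE) eqX.
have [lt_dr|le_rd] := ltnP d r.+1; last first.
  by apply: IHd => k le_dk; have := leq_trans (ltn_ord k) (leq_trans le_rd le_dk);
     rewrite ltnn.
pose j := Ordinal lt_dr.
have updpE : p =1 updf p j (p j).
  by move=> i; rewrite /updf; case: eqP => // ->.
rewrite (multilin_ext linmu updpE) (multilin_ext linnu updpE).
rewrite -[p j]coefK poly_def; move: (size (p j)) => n.
elim: n => [|n IHn]; first by rewrite big_ord0 !multilin_updf0.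
rewrite big_ord_recr /= addrC !multilin_updf // IHn; congr (_ * _ + _).
apply: IHd => k le_dk; have [->|ne_kj] := eqVneq k j.
  by rewrite updf_id; exists n.
rewrite updf_neq //; apply: monp; rewrite ltn_neqAle le_dk andbT.
by apply: contra ne_kj => /eqP e; apply/eqP/val_inj.
Qed.

End MultilinearExtension.

(** * Products of univariate polynomials in separate variables *)

Section TensorProducts.
Variables (r : nat).
Implicit Type R : comNzRingType.

Definition atX R (j : 'I_r.+1) : {poly R} -> {mpoly R[r.+1]} := horner_alg 'X_j.


Definition tprod R (p : 'I_r.+1 -> {poly R}) : {mpoly R[r.+1]} :=
  \prod_j atX j (p j).

Lemma atX_X R j : atX j 'X = 'X_j :> {mpoly R[r.+1]}.
Proof. exact: horner_algX. Qed.

Lemma atX_Z R j c p : atX j (c *: p) = c *: atX j p :> {mpoly R[r.+1]}.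
Proof. by rewrite /atX linearZ /= mulr_algl. Qed.

Lemma atXD R j p q : atX j (p + q) = atX j p + atX j q :> {mpoly R[r.+1]}.
Proof. exact: (rmorphD (horner_alg _)). Qed.

Lemma atXM R j p q : atX j (p * q) = atX j p * atX j q :> {mpoly R[r.+1]}.
Proof. exact: (rmorphM (horner_alg _)). Qed.

Lemma atX0 R j : atX j 0 = 0 :> {mpoly R[r.+1]}.
Proof. exact: (rmorph0 (horner_alg _)). Qed.

Lemma atXC R j c : atX j c%:P = c *: 1 :> {mpoly R[r.+1]}.
Proof. exact: horner_algC. Qed.

Lemma atX_Xn R j n : atX j 'X^n = 'X_j ^+ n :> {mpoly R[r.+1]}.
Proof. by rewrite -atX_X; exact: (rmorphXn (horner_alg _)). Qed.

Lemma tprodD1 R (p : 'I_r.+1 -> {poly R}) j :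
  tprod p = atX j (p j) * \prod_(i | i != j) atX i (p i).
Proof. exact: bigD1. Qed.

Lemma tprod_multilin R : multilin (@mpolyC r.+1 R) (@tprod R).
Proof.
move=> p p1 p2 j c pj pi1 pi2; rewrite !(tprodD1 _ j) pj atXD atX_Z mulrDl mul_mpolyC -scalerAl.
congr (_ *: (_ * _) + _ * _).
  by apply: eq_bigr => i ne; rewrite pi1.
by apply: eq_bigr => i ne; rewrite pi2.
Qed.

Lemma tprodX R (m : 'X_{1..r.+1}) : tprod (fun k => 'X^(m k)) = 'X_[m] :> {mpoly R[r.+1]}.
Proof.
by rewrite mpolyXE_id; apply: eq_bigr => j _; rewrite atX_Xn.
Qed.

Lemma eq_tprod R (p p' : 'I_r.+1 -> {poly R}) : p =1 p' -> tprod p = tprod p'.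
Proof. by move=> eqp; apply: eq_bigr => j _; rewrite eqp. Qed.

Lemma tprod_monom R (m : 'I_r.+1 -> nat) :
  tprod (fun k => 'X^(m k)) = 'X_[[multinom m k | k < r.+1]] :> {mpoly R[r.+1]}.
Proof. by rewrite -tprodX; apply: eq_tprod => k; rewrite mnmE. Qed.

Lemma tprodM R (p q : 'I_r.+1 -> {poly R}) :
  tprod (fun k => p k * q k) = tprod p * tprod q.
Proof. by rewrite -big_split; apply: eq_bigr => j _; exact: atXM. Qed.

Lemma atX_tprod R k (q : {poly R}) p :
  atX k q * tprod p = tprod (updf p k (q * p k)).
Proof.
rewrite !(tprodD1 _ k) updf_id atXM mulrA; congr (_ * _).
by apply: eq_bigr => i ne; rewrite updf_neq.
Qed.

Lemma tprod0 R (p : 'I_r.+1 -> {poly R}) j : p j = 0 -> tprod p = 0.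
Proof. by move=> pj0; rewrite (tprodD1 _ j) pj0 atX0 mul0r. Qed.

(** Both sides are multilinear in [p] and agree on families of powers. Hence [mext] can be computed
    on pure tensors without expanding them. *)
Lemma mext_tprod R (S : comNzRingType) (f : {rmorphism R -> S}) mu p :
  multilin f mu -> mext f mu (tprod p) = mu p.
Proof.
move=> linmu; apply: (@eq_multilin R S f r (mext f mu \o @tprod R)) => //= [|m].
  move=> p' p1 p2 j c pj pi1 pi2 /=; rewrite (tprod_multilin pj pi1 pi2).
  by rewrite /= mul_mpolyC mext_semilin.
by rewrite tprod_monom mextX; apply: multilin_ext linmu _ => k; rewrite mnmE.
Qed.

Lemma mcoeff_tprod R (p : 'I_r.+1 -> {poly R}) m :
  (tprod p)@_m = \prod_j (p j)`_(m j).
Proof.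
pose lhs q := (@tprod R q)@_m; pose rhs (q : 'I_r.+1 -> {poly R}) := \prod_j (q j)`_(m j).
apply: (@eq_multilin R R idfun r lhs rhs) => [q q1 q2 j c qj qi1 qi2 | q q1 q2 j c qj qi1 qi2 | m'].
- by rewrite /lhs (tprod_multilin qj qi1 qi2) mcoeffD mul_mpolyC mcoeffZ.
- pose tail (q' : 'I_r.+1 -> {poly R}) := \prod_(i | i != j) (q' i)`_(m i).
  have rhsE q' : rhs q' = (q' j)`_(m j) * tail q' by exact: bigD1.
  rewrite !rhsE qj coefD coefZ mulrDl -mulrA; congr (_ * (_ * _) + _ * _);
  by apply: eq_bigr => i ne; rewrite -?qi1 -?qi2.
rewrite /lhs tprod_monom mcoeffX /rhs.
have [<-|ne] := eqVneq [multinom m' k | k < r.+1] m.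
  by rewrite big1 // => j _; rewrite coefXn mnmE eqxx.
have [j nej] : exists j, m' j != m j.
  apply/existsP; apply: contraNT ne => /existsPn eqm.
  by apply/eqP/mnmP => j; rewrite mnmE; apply/eqP; have := eqm j; rewrite negbK.
by rewrite (bigD1 j) //= coefXn eq_sym (negPf nej) mul0r.
Qed.

Lemma map_mpoly_atX R (S : comNzRingType) (f : {rmorphism R -> S}) j p :
  map_mpoly f (atX j p) = atX j (map_poly f p).
Proof.
elim/poly_ind: p => [|p c IHp]; first by rewrite rmorph0 !atX0 rmorph0.
rewrite atXD atXM atX_X atXC rmorphD rmorphM /= map_mpolyZ rmorph1 map_mpolyX IHp.
by rewrite rmorphD rmorphM /= map_polyX map_polyC atXD atXM atX_X atXC.
Qed.

Lemma map_mpoly_tprod R (S : comNzRingType) (f : {rmorphism R -> S}) p :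
  map_mpoly f (@tprod R p) = tprod (fun k => map_poly f (p k)).
Proof. by rewrite rmorph_prod; apply: eq_bigr => j _; exact: map_mpoly_atX. Qed.

End TensorProducts.

(** * Reduction modulo [a] in every variable, and divided differences *)

Section NormalForm.
Variables (r : nat).
Implicit Type F : fieldType.

(** The normal form modulo the ideal generated by the [a('X_j)], obtained by taking remainders in
    each tensor factor. *)
Definition nf F (a : {poly F}) : {mpoly F[r.+1]} -> {mpoly F[r.+1]} :=
  mext (@mpolyC r.+1 F) (fun p => tprod (fun k => p k %% a)).

Lemma tprod_modp_multilin F (a : {poly F}) :
  multilin (@mpolyC r.+1 F) (fun p => tprod (fun k => p k %% a)).
Proof.
move=> p p1 p2 j c pj pi1 pi2; apply: (@tprod_multilin r F _ _ _ j).
- by rewrite pj modpD modpZl.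
- by move=> i ne; rewrite pi1.
- by move=> i ne; rewrite pi2.
Qed.

Lemma nf_semilin F (a : {poly F}) : semilin (@mpolyC r.+1 F) (nf a).
Proof. exact: mext_semilin. Qed.

Lemma nf_tprod F (a : {poly F}) p : nf a (tprod p) = tprod (fun k => p k %% a).
Proof. exact: (mext_tprod p (tprod_modp_multilin a)). Qed.

Lemma nfX F (a : {poly F}) m : nf a 'X_[m] = tprod (fun k => 'X^(m k) %% a).
Proof. exact: mextX. Qed.

Lemma mcoeff_nf_eq0 F (a : {poly F}) P (m : 'X_{1..r.+1}) j :
  a != 0 -> ((size a).-1 <= m j)%N -> (nf a P)@_m = 0.
Proof.
move=> a0 le_am; rewrite /nf /mext raddf_sum big1 // => m' _.
rewrite /= mul_mpolyC mcoeffZ mcoeff_tprod (bigD1 j) //= nth_default ?mul0r ?mulr0 //.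
apply: leq_trans le_am; rewrite -ltnS prednK ?ltn_modp //.
by rewrite size_poly_gt0.
Qed.

(** Remainders have degree below that of [a], so the exponents range over exactly the index type of
    the sum in [weil]. *)
Lemma nf_expand F (a : {poly F}) P : a != 0 ->
  nf a P = \sum_(i : {ffun 'I_r.+1 -> 'I_(size a).-1})
    (nf a P)@_[multinom (i k : nat) | k < r.+1]
      *: 'X_[[multinom (i k : nat) | k < r.+1]].
Proof.
move=> a0; apply/mpolyP => m; rewrite [RHS]raddf_sum /=.
have [lt_m|] := boolP [forall j, m j < (size a).-1]%N; last first.
  case/forallPn=> j; rewrite -leqNgt => le_m; rewrite (mcoeff_nf_eq0 P a0 le_m).
  rewrite big1 // => i _; rewrite mcoeffZ mcoeffX; case: eqP => [e|_]; last by rewrite mulr0.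
  by move: le_m; rewrite -e mnmE leqNgt ltn_ord.
pose i0 : {ffun 'I_r.+1 -> 'I_(size a).-1} := [ffun j => Ordinal (forallP lt_m j)].
have i0E : [multinom (i0 k : nat) | k < r.+1] = m.
  by apply/mnmP => j; rewrite mnmE ffunE.
rewrite (bigD1 i0) //= i0E mcoeffZ mcoeffX eqxx mulr1 big1 ?addr0 // => i ne.
rewrite mcoeffZ mcoeffX; case: eqP => [e|_]; last by rewrite mulr0.
case/eqP: ne; apply/ffunP => j; apply: val_inj.
by rewrite ffunE /= -e mnmE.
Qed.

Lemma map_mpoly_nf F (F' : fieldType) (f : {rmorphism F -> F'}) (a : {poly F}) P :
  map_mpoly f (nf a P) = nf (map_poly f a) (map_mpoly f P).
Proof.
move: P; apply: (@eq_semilin _ _ (@mpolyC r.+1 F' \o f)) => [c P Q|c P Q|m] /=.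
- by rewrite nf_semilin rmorphD rmorphM /= map_mpolyC.
- by rewrite rmorphD /= map_mpolyZ nf_semilin.
rewrite map_mpolyX !nfX map_mpoly_tprod; apply: eq_tprod => k.
by rewrite map_modp map_polyXn.
Qed.

(** The quotient of [a('X_i) - a('X_j)] by ['X_i - 'X_j], written out monomial by monomial to avoid
    division. *)
Definition divdiff F (a : {poly F}) (i j : 'I_r.+1) : {mpoly F[r.+1]} :=
  \sum_(n < size a) a`_n *: \sum_(k < n) 'X_i ^+ (n.-1 - k) * 'X_j ^+ k.

Lemma atXE F j (a : {poly F}) :
  atX j a = \sum_(n < size a) a`_n *: 'X_j ^+ n :> {mpoly F[r.+1]}.
Proof.
rewrite -[in LHS](coefK a) poly_def.
rewrite (big_morph (atX j) (atXD j) (atX0 F j)).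
by apply: eq_bigr => n _; rewrite atX_Z atX_Xn.
Qed.

Lemma divdiffE F (a : {poly F}) i j :
  ('X_i - 'X_j) * divdiff a i j = atX i a - atX j a.
Proof.
rewrite !atXE -sumrB mulr_sumr; apply: eq_bigr => n _.
by rewrite -scalerAr -subrXX scalerBr.
Qed.

Lemma subX_neq0 F (i j : 'I_r.+1) : i != j -> 'X_i - 'X_j != 0 :> {mpoly F[r.+1]}.
Proof.
move=> ne; apply/eqP => /(congr1 (mcoeff U_(i)%MM)).
rewrite mcoeffB mcoeff0 !mcoeffXU eqxx eq_sym (negPf ne) subr0.
by move/eqP; rewrite oner_eq0.
Qed.

Lemma divdiff_unique F (a : {poly F}) i j h : i != j ->
  ('X_i - 'X_j) * h = atX i a - atX j a -> h = divdiff a i j.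
Proof. by move=> ne; rewrite -divdiffE => /(mulfI (subX_neq0 F ne)). Qed.

Lemma divdiffM F (a b : {poly F}) i j : i != j ->
  divdiff (a * b) i j = atX i a * divdiff b i j + atX j b * divdiff a i j.
Proof.
move=> ne; apply/esym/divdiff_unique => //.
rewrite mulrDr mulrCA divdiffE [X in _ + X]mulrCA divdiffE !atXM !mulrBr.
by rewrite [atX j b * _]mulrC addrA [atX j a * _]mulrC subrK.
Qed.

Lemma map_mpoly_divdiff F (F' : fieldType) (f : {rmorphism F -> F'}) a i j :
  i != j -> map_mpoly f (divdiff a i j) = divdiff (map_poly f a) i j.
Proof.
move=> ne; apply: divdiff_unique => //.
have := congr1 (map_mpoly f) (divdiffE a i j).
by rewrite rmorphM !rmorphB /= !map_mpolyX !map_mpoly_atX.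
Qed.

Lemma inord_neqS (t : 'I_r) : inord t != inord t.+1 :> 'I_r.+1.
Proof.
by rewrite -val_eqE /= !inordK ?neq_ltn ?ltnS ?leqnn // ltnW.
Qed.

(** The number [n] of links is a parameter to allow induction on it; the full product is
    [chain a r]. *)
Definition chain F (a : {poly F}) (n : nat) : {mpoly F[r.+1]} :=
  \prod_(t < n) divdiff a (inord t) (inord t.+1).

Lemma chainS F (a : {poly F}) n :
  chain a n.+1 = chain a n * divdiff a (inord n) (inord n.+1).
Proof. exact: big_ord_recr. Qed.

Lemma map_mpoly_chain F (F' : fieldType) (f : {rmorphism F -> F'}) a :
  map_mpoly f (chain a r) = chain (map_poly f a) r.
Proof.
rewrite rmorph_prod; apply: eq_bigr => t _.
exact/map_mpoly_divdiff/inord_neqS.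
Qed.

End NormalForm.

(** * The sum over tuples of roots as a normal form *)

Section RootSum.
Variables (E : fieldType) (n r : nat) (alpha : n.-tuple E).
Hypothesis n_gt0 : (0 < n)%N.

Local Notation fac k := ('X - (tnth alpha k)%:P).

Let aa : {poly E} := \prod_(k < n) fac k.
(** [low i] and [high i] are the two complementary factors of [aa] obtained by cutting the list of
    roots at [i]. *)
Let low (i : nat) : {poly E} := \prod_(k < n) if (k < i)%N then fac k else 1.
Let high (i : nat) : {poly E} := \prod_(k < n) if (i <= k)%N then fac k else 1.

Let low0 : low 0 = 1. Proof. by rewrite /low big1. Qed.

Let lown : low n = aa. Proof. by apply: eq_bigr => k _; rewrite ltn_ord. Qed.

Let high0 : high 0 = aa. Proof. by []. Qed.

Let highn : high n = 1.
Proof. by rewrite /high big1 // => k _; rewrite leqNgt ltn_ord. Qed.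

Let lowS (i : 'I_n) : low i.+1 = fac i * low i.
Proof.
rewrite /low (bigD1 i) //= ltnSn [in RHS](bigD1 i) //= ltnn mul1r; congr (_ * _).
apply: eq_bigr => k ne; rewrite ltnS leq_eqVlt.
by rewrite (negPf (_ : k != i :> nat)).
Qed.

Let highS (i : 'I_n) : high i = fac i * high i.+1.
Proof.
rewrite /high (bigD1 i) //= leqnn [in RHS](bigD1 i) //= ltnn mul1r; congr (_ * _).
apply: eq_bigr => k ne; rewrite [in LHS]leq_eqVlt eq_sym.
by rewrite (negPf (_ : k != i :> nat)).
Qed.

Let atX_fac (j : 'I_r.+1) k : atX j (fac k) = 'X_j - (tnth alpha k)%:MP.
Proof. by rewrite -[in LHS]polyCN atXD atXC atX_X scaleNr -mul_mpolyC mulr1. Qed.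

Let divdiff_roots (x y : 'I_r.+1) : x != y ->
  divdiff aa x y = \sum_(i < n) atX x (high i.+1) * atX y (low i).
Proof.
move=> ne; apply/esym/divdiff_unique => //; rewrite mulr_sumr.
(* After multiplication by ['X_x - 'X_y] the sum telescopes, from [T 0 = - aa('X_x)] to
   [T n = - aa('X_y)]. *)
pose T i : {mpoly E[r.+1]} := - (atX x (high i) * atX y (low i)).
transitivity (\sum_(i < n) (T i.+1 - T i)).
  apply: eq_bigr => i _; rewrite /T opprK [in X in _ = X + _]lowS highS !atXM.
  rewrite !atX_fac; set u := atX x _; set v := atX y _; set c := _%:MP.
  by ring.
rewrite -(big_mkord xpredT (fun i => T i.+1 - T i)) telescope_sumr //.
rewrite /T low0 lown high0 highn opprK addrC.
by rewrite -polyC1 !atXC !scale1r mul1r mulr1.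
Qed.

Let low_high_mono (u v : nat) : (u <= v)%N ->
  low u * high v.+1 = \prod_(k < n | ~~ (u <= k <= v)%N) fac k.
Proof.
move=> le_uv; rewrite big_mkcond -big_split; apply: eq_bigr => k _ /=.
rewrite negb_and -!ltnNge; case: (ltnP k u) => /= [lt_ku|le_uk]; last by rewrite mul1r.
by rewrite ltnNge (leq_trans (ltnW lt_ku) le_uv) mulr1.
Qed.

Let aa_size : size aa = n.+1.
Proof. by rewrite size_prod_XsubC -sum1_size sum_nat_const card_ord muln1. Qed.

(** The root of index [u] is left out of the product, so its degree is less than [n]. *)
Let modp_low_high_mono (u v : 'I_n) : (u <= v)%N ->
  (low u * high v.+1) %% aa = low u * high v.+1.
Proof.
move=> le_uv; rewrite modp_small // low_high_mono // aa_size.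
rewrite -big_filter size_prod_XsubC ltnS size_filter.
set s := index_enum _; set P : pred 'I_n := fun k => ~~ _.
have s_size : size s = n by rewrite -sum1_size sum_nat_const card_ord muln1.
rewrite -[X in (_ < X)%N]s_size -(count_predC P s) -[X in (X < _)%N]addn0 ltn_add2l.
by rewrite -has_count; apply/hasP; exists u; rewrite ?mem_index_enum //= negbK leqnn.
Qed.

(** The two factors together cover all roots; the quotient by [aa] is their overlap, the roots of
    index strictly between [v] and [u]. *)
Let modp_low_high_lt (u v : nat) : (v < u)%N -> (low u * high v.+1) %% aa = 0.
Proof.
move=> lt_vu; apply/eqP; rewrite -/(aa %| _).
apply/dvdpP; exists (\prod_(k < n) if (v < k < u)%N then fac k else 1).
rewrite -!big_split; apply: eq_bigr => k _ /=.
case: (ltnP k u) => [lt_ku|le_uk]; case: (ltnP v k) => [lt_vk|le_kv] /=.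
- by [].
- by rewrite mulr1 mul1r.
- by [].
- by have := leq_trans lt_vu (leq_trans le_uk le_kv); rewrite ltnn.
Qed.

(** Each link is a sum by [divdiff_roots], and distributing gives tuples. The link between variables
    [k-1] and [k] has summation index [f k]; variable [j] thus receives [low] at [f j] and [high] at
    [f (j+1)]. *)
Let chain_roots : chain r aa r =
  \sum_(f : {ffun 'I_r.+2 -> 'I_n} |
        (f ord0 == 0%N :> nat) && (f ord_max == n.-1 :> nat))
    tprod (fun j : 'I_r.+1 => low (f (lift ord_max j)) * high (f (lift ord0 j)).+1).
Proof.
(* The end indices [0] and [r+1] have a variable on one side only, whence the default 1. Pinning
   them at [0] and [n-1] makes their remaining factors [low 0] and [high n] equal to 1 as well. *)
pose lowat (k : 'I_r.+2) (i : 'I_n) : {mpoly E[r.+1]} :=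
  if unlift ord_max k is Some j then atX j (low i) else 1.
pose highat (k : 'I_r.+2) (i : 'I_n) : {mpoly E[r.+1]} :=
  if unlift ord0 k is Some j then atX j (high i.+1) else 1.
pose Q (k : 'I_r.+2) (i : 'I_n) :=
  ((k == ord0) ==> (i == 0%N :> nat)) && ((k == ord_max) ==> (i == n.-1 :> nat)).
have atX1 j : atX j 1 = 1 :> {mpoly E[r.+1]} by rewrite -polyC1 atXC scale1r.
transitivity (\prod_(k < r.+2) \sum_(i | Q k i) highat k i * lowat k i).
  rewrite big_ord_recl big_ord_recr /=.
  rewrite (big_pred1 (Ordinal n_gt0)); last first.
    by move=> i; rewrite /Q /= andbT -val_eqE.
  have lt_n1 : (n.-1 < n)%N by rewrite prednK.
  rewrite [X in _ * (_ * X)](big_pred1 (Ordinal lt_n1)); last first.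
    move=> i; rewrite /Q (_ : lift ord0 ord_max = ord_max) ?eqxx; first by rewrite -val_eqE.
    exact: val_inj.
  rewrite /highat /lowat unlift_none liftK /= prednK // highn atX1.
  rewrite (_ : lift ord0 ord_max = ord_max :> 'I_r.+2); last exact: val_inj.
  rewrite unlift_none.
  rewrite [X in unlift ord_max X](_ : _ = lift ord_max ord0); last exact: val_inj.
  rewrite liftK low0 atX1 !mulr1 mul1r; apply: eq_bigr => t _.
  rewrite divdiff_roots ?inord_neqS //; apply: eq_big => [i|i _].
    by rewrite /Q /= -val_eqE /= /bump /= eqSS ltn_eqF.
  rewrite liftK (_ : lift ord0 _ = lift ord_max (inord t.+1)).
    by rewrite liftK; congr (atX _ _ * _); apply: val_inj; rewrite /= inordK // ltnS ltnW.
  apply: val_inj; rewrite /= /bump /= inordK ?ltnS //.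
  by rewrite leqNgt ltn_ord.
rewrite bigA_distr_big_dep; apply: eq_big => [f|f _].
  apply/familyP/andP => [famf|[f0 fm] k].
    have := famf ord0; have := famf ord_max; rewrite !unfold_in /= /Q !eqxx /=.
    by rewrite ?andbT => -> ->.
  by rewrite unfold_in /= /Q; apply/andP; split; apply/implyP => /eqP ->.
rewrite big_split /= mulrC tprodM; congr (_ * _).
  rewrite big_ord_recr /= {2}/lowat unlift_none mulr1; apply: eq_bigr => j _.
  rewrite (_ : widen_ord _ j = lift ord_max j) /lowat ?liftK //.
  by apply: val_inj; rewrite /= /bump leqNgt ltn_ord.
rewrite big_ord_recl /= {1}/highat unlift_none mul1r.
by apply: eq_bigr => j _; rewrite /highat liftK.
Qed.

(* Non-monotone tuples contribute multiples of some [aa('X_j)], which [nf]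
   kills; monotone ones are already reduced. *)
Lemma fsum_nf : fsum r.+1 alpha = nf aa (chain r aa r).
Proof.
rewrite chain_roots (semilin_sum _ _ _ (nf_semilin aa)).
pose mono (f : {ffun 'I_r.+2 -> 'I_n}) :=
  [forall j : 'I_r.+1, (f (widen_ord (leqnSn r.+1) j) <= f (lift ord0 j))%N].
have widenE (j : 'I_r.+1) : widen_ord (leqnSn r.+1) j = lift ord_max j.
  by apply: val_inj; rewrite /= /bump leqNgt ltn_ord.
rewrite (bigID mono) /= [X in _ = _ + X]big1 ?addr0 => [|f /andP[_]]; last first.
  case/forallPn => j; rewrite -ltnNge widenE => lt_f.
  by rewrite nf_tprod (@tprod0 _ _ _ j) // modp_low_high_lt.
apply: eq_big => [f|f /and3P[_ _ /forallP monof]]; first by rewrite andbA.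
rewrite nf_tprod; apply: eq_bigr => j _.
have le_f := monof j; rewrite modp_low_high_mono -?widenE // low_high_mono //.
rewrite (big_morph (atX j) (atXM j) (_ : atX j 1 = 1)); last first.
  by rewrite -polyC1 atXC scale1r.
by apply: eq_bigr => k _; rewrite atX_fac.
Qed.

End RootSum.
(** Remainders and divided differences commute with field extension, so the description over the
    splitting field descends to [F]. *)
Lemma fpoly_nf (F : fieldType) (E : closedFieldType) (jota : {rmorphism F -> E})
    (r : nat) (a : {poly F}) : a \is monic -> (1 <= (size a).-1)%N ->
  fpoly r.+1 (map_poly jota a) = map_mpoly jota (nf a (chain r a r)).
Proof.
move=> a_monic a_deg; rewrite map_mpoly_nf map_mpoly_chain /fpoly.
case: closed_field_poly_normal => s /= aE.
have {}aE : map_poly jota a = \prod_(z <- s) ('X - z%:P).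
  by rewrite aE lead_coef_map (monicP a_monic) rmorph1 scale1r.
have s_gt0 : (0 < size s)%N.
  by move: a_deg; rewrite -(size_map_poly jota) aE size_prod_XsubC.
by rewrite fsum_nf // aE [in RHS](big_tnth _ _ s).
Qed.

(** [fpoly_nf] exhibits a preimage of the coefficient, so the [pick] succeeds, and injectivity of
    [jota] identifies its result. *)
Lemma fcoef_nf (Fq : finFieldType) (E : closedFieldType)
    (jota : {rmorphism Fq -> E}) (r : nat) (a : {poly Fq}) (m : 'X_{1..r.+1}) :
  a \is monic -> (1 <= (size a).-1)%N ->
  fcoef jota a m = (nf a (chain r a r))@_m.
Proof.
move=> a_monic a_deg; rewrite /fcoef fpoly_nf // mcoeff_map_mpoly.
by case: pickP => [c /eqP /fmorph_inj //|/(_ (nf a (chain r a r))@_m)]; rewrite eqxx.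
Qed.

Lemma sum_ord_trunc (V : nmodType) n N (G : nat -> V) : (n <= N)%N ->
  (forall i, (n <= i)%N -> G i = 0) -> \sum_(i < N) G i = \sum_(i < n) G i.
Proof.
move=> le_nN G0; rewrite (big_ord_widen N G le_nN) [RHS]big_mkcond.
by apply: eq_bigr => i _; case: ltnP => // /G0.
Qed.

(** * The action of the twisted polynomials on an extension field *)

Section Action.
Variables (Fq : finFieldType) (K : fieldType) (iota : {rmorphism Fq -> K}).
Variables (L : fieldType) (emb : {rmorphism K -> L}).
Local Notation q := #|Fq|.
Local Notation sc := (emb \o iota).
Implicit Types (p : twpoly iota) (x y : L).

Lemma expD_card i x y : (x + y) ^+ (q ^ i) = x ^+ (q ^ i) + y ^+ (q ^ i).
Proof.
by apply: exprDn_pchar; rewrite pnatX (pchar_nat_card sc).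
Qed.

Lemma exp_card_sum i (I : Type) (s : seq I) (P : pred I) (G : I -> L) :
  (\sum_(k <- s | P k) G k) ^+ (q ^ i) = \sum_(k <- s | P k) G k ^+ (q ^ i).
Proof.
apply: (big_morph (fun x => x ^+ (q ^ i))) => [x y|]; first exact: expD_card.
by rewrite expr0n expn_eq0 (gtn_eqF (ltnW (finNzRing_gt1 Fq))).
Qed.

Lemma exp_card_sc i c : sc c ^+ (q ^ i) = sc c.
Proof.
by elim: i => [|i IHi]; rewrite ?expr1 // expnS exprM -rmorphXn expf_card.
Qed.

Lemma emb_iter_frob i (c : K) : emb (iter i (frob iota) c) = emb c ^+ (q ^ i).
Proof.
by elim: i => [|i IHi] /=; rewrite ?expr1 // /frob rmorphXn /= IHi -exprM -expnSr.
Qed.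

Lemma twactE n p x : (skewsize p <= n)%N ->
  twact emb p x = \sum_(i < n) emb (skewcoef p i) * x ^+ (q ^ i).
Proof.
move=> le_pn; apply/esym.
apply: (@sum_ord_trunc _ _ _ (fun i => emb (skewcoef p i) * x ^+ (q ^ i))) => // i le_i.
by rewrite /skewcoef nth_default // rmorph0 mul0r.
Qed.

Lemma twactDl p1 p2 x : twact emb (p1 + p2) x = twact emb p1 x + twact emb p2 x.
Proof.
pose n := maxn (skewsize p1) (skewsize p2).
rewrite (@twactE n) ?size_polyD // !(@twactE n) ?leq_maxl ?leq_maxr //.
rewrite -big_split; apply: eq_bigr => i _.
by rewrite /skewcoef coefD rmorphD mulrDl.
Qed.

Lemma twactDr p x y : twact emb p (x + y) = twact emb p x + twact emb p y.
Proof.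
by rewrite -big_split; apply: eq_bigr => i _; rewrite expD_card mulrDr.
Qed.

Lemma twact0r p : twact emb p 0 = 0.
Proof.
by have := twactDr p 0 0 => /(congr1 (+%R^~ (- twact emb p 0)));
  rewrite addr0 addrK subrr.
Qed.

Lemma twactZ p c x : twact emb p (sc c * x) = sc c * twact emb p x.
Proof.
rewrite mulr_sumr; apply: eq_bigr => i _.
by rewrite exprMn exp_card_sc mulrCA.
Qed.

Lemma twactC c x : twact emb (skewC (frob iota) c) x = emb c * x.
Proof.
by rewrite (@twactE 1) ?size_polyC_leq1 // big_ord1 /skewcoef coefC expr1.
Qed.

Lemma twactM p1 p2 x : twact emb (p1 * p2) x = twact emb p1 (twact emb p2 x).
Proof.
pose n1 := skewsize p1; pose n2 := skewsize p2.
(* [B i j] is the contribution of the terms of degrees [i] and [j]. It vanishes outside the [n1] by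
   [n2] rectangle, so summing along the diagonals [i + j = k] for [k < n1 + n2] gives the same
   total. *)
pose B i j := emb (skewcoef p1 i) * (emb (skewcoef p2 j) * x ^+ (q ^ j)) ^+ (q ^ i).
have B0l i j : (n1 <= i)%N -> B i j = 0.
  by move=> le_i; rewrite /B /skewcoef nth_default // rmorph0 mul0r.
have B0r i j : (n2 <= j)%N -> B i j = 0.
  move=> le_j; rewrite /B /skewcoef [p2`__]nth_default // rmorph0 mul0r.
  by rewrite expr0n expn_eq0 (gtn_eqF (ltnW (finNzRing_gt1 Fq))) mulr0.
transitivity (\sum_(i < n1) \sum_(j < n2) B i j); last first.
  by apply: eq_bigr => i _; rewrite exp_card_sum mulr_sumr.
pose N := (n1 + n2)%N.
transitivity (\sum_(k < N) \sum_(i < N | (i < k.+1)%N) B i (k - i)%N).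
  rewrite (@twactE N) ?size_poly //; apply: eq_bigr => k _.
  rewrite -(big_ord_widen N (fun i => B i (k - i)%N)) //.
  have -> : skewcoef (p1 * p2) k = \sum_(i < k.+1)
      skewcoef p1 i * iter i (frob iota) (skewcoef p2 (k - i)).
    exact: coef_skewmul.
  rewrite rmorph_sum mulr_suml.
  apply: eq_bigr => i _; rewrite /B rmorphM -mulrA exprMn -exprM -expnD subnK ?leq_ord //.
  by rewrite emb_iter_frob.
rewrite (exchange_big_dep predT) //= (@sum_ord_trunc _ n1 N
  (fun i => \sum_(k < N | (i < k.+1)%N) B i (k - i)%N)) ?leq_addr //; last first.
  by move=> i le_i; rewrite big1 // => k _; rewrite B0l.
apply: eq_bigr => i _; rewrite -(@big_geq_mkord _ _ _ i N xpredT (fun k => B i (k - i)%N)).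
rewrite -{1}[i : nat]add0n big_addn big_mkord.
rewrite (@sum_ord_trunc _ n2 _ (fun j => B i (j + i - i)%N)); last first.
- by move=> j le_j; rewrite addnK B0r.
- by rewrite -addnBAC ?leq_addl // ltnW.
by apply: eq_bigr => j _; rewrite addnK.
Qed.

End Action.

(** * The linear functional given by the Moore determinant *)

Section MooreFunctional.
Variables (Fq : finFieldType) (K : fieldType) (iota : {rmorphism Fq -> K}).
Variables (L : fieldType) (emb : {rmorphism K -> L}) (r : nat).
Variables (phi : {rmorphism {poly Fq} -> twpoly iota}).
Hypothesis phiC : forall c : Fq, phi c%:P = skewC (frob iota) (iota c).
Local Notation q := #|Fq|.
Local Notation sc := (emb \o iota).
Local Notation act p x := (twact emb (phi p) x).
Implicit Types (x beta : 'I_r.+1 -> L) (p : 'I_r.+1 -> {poly Fq}).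
Implicit Types (w : 'I_r.+1 -> 'I_r.+1 -> L).

Lemma actZ c (a : {poly Fq}) (y : L) : act (c *: a) y = sc c * act a y.
Proof. by rewrite -mul_polyC rmorphM /= phiC twactM twactC. Qed.

Lemma actD (a b : {poly Fq}) (y : L) : act (a + b) y = act a y + act b y.
Proof. by rewrite rmorphD twactDl. Qed.

Lemma actM (a b : {poly Fq}) (y : L) : act (a * b) y = act a (act b y).
Proof. by rewrite rmorphM twactM. Qed.

(** Weights let the Moore determinant ([unitw]) and the single terms of its expansion along the
    first column ([rowk]) share the lemmas below. *)
Definition wmoore w x : L := \det (\matrix_(i, j) (w i j * x i ^+ (q ^ j))).

Definition wact w beta p : L := wmoore w (fun k => act (p k) (beta k)).

Definition wfun w beta : {mpoly Fq[r.+1]} -> L := mext sc (wact w beta).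

Lemma eq_wmoore w x x' : x =1 x' -> wmoore w x = wmoore w x'.
Proof.
by move=> eqx; congr (\det _); apply/matrixP => i j; rewrite !mxE eqx.
Qed.

Lemma wmoore_eq0 w x k : x k = 0 -> wmoore w x = 0.
Proof.
move=> xk0; rewrite /wmoore (expand_det_row _ k) big1 // => j _.
by rewrite mxE xk0 expr0n expn_eq0 (gtn_eqF (ltnW (finNzRing_gt1 Fq))) mulr0 mul0r.
Qed.

(** Only row [k] involves [p k], and the q-power maps are additive and fix the image of [Fq]. *)
Lemma wact_multilin w beta : multilin sc (wact w beta).
Proof.
move=> p p1 p2 k c pk pi1 pi2; rewrite -[X in _ + X]mul1r.
apply: (determinant_multilinear (i0 := k)).
- apply/rowP => j; rewrite !mxE pk actD actZ.
  by rewrite (expD_card iota emb) exprMn exp_card_sc mul1r mulrDr mulrCA.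
- by apply/matrixP => i j; rewrite !mxE pi1 // eq_sym neq_lift.
- by apply/matrixP => i j; rewrite !mxE pi2 // eq_sym neq_lift.
Qed.

Lemma wfun_semilin w beta : semilin sc (wfun w beta).
Proof. exact: mext_semilin. Qed.

Lemma wfun_tprod w beta p : wfun w beta (tprod p) = wact w beta p.
Proof. exact: (mext_tprod p (wact_multilin w beta)). Qed.

(** On a monomial, commutativity of the polynomial ring lets [phi a] act first on [beta k], which
    makes row [k] zero. *)
Lemma wfun_annihil w beta k a P :
  act a (beta k) = 0 -> wfun w beta (atX k a * P) = 0.
Proof.
move=> a0; move: P.
apply: (eq_semilin (semilinM _ (wfun_semilin w beta)) (G := fun=> 0)) => [c P Q|m].
  by rewrite mulr0 addr0.
rewrite -tprodX atX_tprod wfun_tprod.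
by apply: (@wmoore_eq0 _ _ k); rewrite updf_id mulrC actM a0 twact0r.
Qed.

Lemma wfun_nf w beta a P :
  (forall k, act a (beta k) = 0) -> wfun w beta (nf a P) = wfun w beta P.
Proof.
move=> a0; move: P; apply: (eq_semilin _ (wfun_semilin w beta)) => [c P Q|m].
  by rewrite nf_semilin mul_mpolyC wfun_semilin.
rewrite -[in RHS]tprodX nfX !wfun_tprod; apply: eq_wmoore => k.
by rewrite [in RHS](divp_eq 'X^(m k) a) actD actM a0 twact0r add0r.
Qed.

Lemma wfun_tprodM w beta b P :
  wfun w beta (tprod (fun=> b) * P) = wfun w (fun k => act b (beta k)) P.
Proof.
move: P; apply: (eq_semilin (semilinM _ (wfun_semilin w beta)) (wfun_semilin w _)) => m.
rewrite -tprodX -tprodM !wfun_tprod; apply: eq_wmoore => k.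
by rewrite mulrC actM.
Qed.

Definition unitw : 'I_r.+1 -> 'I_r.+1 -> L := fun _ _ => 1.

(* These weights keep, in the expansion along the first column, only the term
   of row [k]. *)
Definition rowk (k : 'I_r.+1) : 'I_r.+1 -> 'I_r.+1 -> L :=
  fun i j => if j == ord0 then (i == k)%:R else 1.

Definition moore_cof x k : L :=
  cofactor (\matrix_(i < r.+1, j < r.+1) x i ^+ (q ^ j)) k ord0.

Lemma eq_moore_cof x x' k : (forall i, i != k -> x i = x' i) ->
  moore_cof x k = moore_cof x' k.
Proof.
move=> eqx; congr (_ * \det _); apply/matrixP => i j; rewrite !mxE eqx //.
by rewrite eq_sym neq_lift.
Qed.

Lemma wmoore_unitw x : wmoore unitw x = moore q x.
Proof. by congr (\det _); apply/matrixP => i j; rewrite !mxE mul1r. Qed.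

Lemma wmoore_rowk k x : wmoore (rowk k) x = x k * moore_cof x k.
Proof.
rewrite /wmoore (expand_det_col _ ord0) (bigD1 k) //= big1 ?addr0 => [|i ne].
  rewrite !mxE /rowk !eqxx mul1r expr1; congr (_ * (_ * \det _)).
  by apply/matrixP => i j; rewrite !mxE mul1r.
by rewrite !mxE /rowk eqxx (negPf ne) !mul0r.
Qed.

Lemma moore_expand x : moore q x = \sum_k x k * moore_cof x k.
Proof.
rewrite /moore (expand_det_col _ ord0); apply: eq_bigr => k _.
by rewrite mxE expr1.
Qed.

Lemma wfun_rowk_sum beta P : \sum_k wfun (rowk k) beta P = wfun unitw beta P.
Proof.
move: P; apply: (@eq_semilin _ _ sc) => [||m].
- by apply: semilin_suml => k; apply: wfun_semilin.
- exact: wfun_semilin.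
rewrite -tprodX wfun_tprod /wact wmoore_unitw moore_expand.
by apply: eq_bigr => k _; rewrite wfun_tprod /wact wmoore_rowk.
Qed.

(** This is the first row of the adjugate identity: for [l] nonzero, column [l] is paired with the
    cofactors of column 0. *)
Lemma moore_cof_exp x (l : 'I_r.+1) :
  \sum_k x k ^+ (q ^ l) * moore_cof x k = moore q x *+ (l == ord0).
Proof.
have := congr1 (fun A : 'M_r.+1 => A ord0 l)
  (mul_adj_mx (\matrix_(i < r.+1, j < r.+1) x i ^+ (q ^ j))).
rewrite !mxE eq_sym => <-; apply: eq_bigr => k _.
by rewrite !mxE mulrC.
Qed.

(* The last column of the q-th power of the Moore matrix moves to the front. *)
Lemma moore_cof_exp_last x :
  \sum_k x k ^+ (q ^ r.+1) * moore_cof x k = (-1) ^+ r * moore q x ^+ q.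
Proof.
have -> : moore q x ^+ q = \det (\matrix_(i < r.+1, j < r.+1) x i ^+ (q ^ j.+1)).
  rewrite -[LHS]/(frob sc (moore q x)) -det_map_mx; congr (\det _).
  by apply/matrixP => i j; rewrite !mxE /= /frob -exprM -expnSr.
rewrite (expand_det_col _ ord_max) mulr_sumr; apply: eq_bigr => k _.
rewrite mxE [RHS]mulrCA; congr (_ * _); rewrite /moore_cof /cofactor mulrA -exprD /=.
congr (_ * _).
  (* The sign [(-1)^r] cancels against the position [(k, r)] of the cofactor, leaving that of
     position [(k, 0)]. *)
  by rewrite addn0 addnCA exprD addnn -mul2n exprM sqrrN !expr1n mulr1.
congr (\det _).
by apply/matrixP => i j; rewrite !mxE lift_max lift0.
Qed.

Variables (gT gr : K) (psi : {rmorphism {poly Fq} -> twpoly iota}).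
Hypothesis psiC : forall c : Fq, psi c%:P = skewC (frob iota) (iota c).
Hypothesis psi_T : psi 'X = skewC (frob iota) gT
  + skewC (frob iota) ((-1) ^+ r * gr) * skewX (frob iota).
Hypothesis phi_T0 : skewcoef (phi 'X) 0 = gT.
Hypothesis phi_Tr : skewcoef (phi 'X) r.+1 = gr.
Hypothesis phi_Tsize : skewsize (phi 'X) = r.+2.

Lemma twact_skewX (y : L) : twact emb (skewX (frob iota)) y = y ^+ q.
Proof.
rewrite (@twactE _ _ _ _ _ 2) ?/skewsize ?size_polyX // !big_ord_recl big_ord0.
by rewrite /skewcoef !coefX /= rmorph0 rmorph1 mul0r mul1r add0r addr0 expn1.
Qed.

(** Expand [phi 'X] in powers of tau. The terms of degree 1 to [r] vanish by [moore_cof_exp]; the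
    two extreme ones are those of [psi 'X] applied to the Moore determinant, which accounts for the
    sign in [psi_T]. *)
Lemma psi_T_moore x :
  twact emb (psi 'X) (moore q x) = \sum_k act 'X (x k) * moore_cof x k.
Proof.
transitivity (\sum_(l < r.+2) emb (skewcoef (phi 'X) l) *
    \sum_k x k ^+ (q ^ l) * moore_cof x k); last first.
  under eq_bigr do rewrite mulr_sumr.
  rewrite exchange_big /=; apply: eq_bigr => k _.
  rewrite (@twactE _ _ _ _ _ r.+2) ?phi_Tsize // mulr_suml.
  by apply: eq_bigr => l _; rewrite mulrA.
rewrite big_ord_recr big_ord_recl /= (moore_cof_exp x ord0) eqxx mulr1n.
rewrite big1 => [|l _]; last first.
  have := moore_cof_exp x (lift ord0 l); rewrite /= /bump /= => ->.
  by rewrite mulr0.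
rewrite moore_cof_exp_last phi_T0 phi_Tr addr0 psi_T twactDl twactM !twactC.
by rewrite twact_skewX rmorphM rmorphXn rmorphN1 mulrCA mulrA.
Qed.

(** Multiplication by ['X_k] changes only argument [k], on which the cofactor of row [k] does not
    depend. *)
Lemma psi_T_wfun beta P :
  twact emb (psi 'X) (wfun unitw beta P) = \sum_k wfun (rowk k) beta ('X_k * P).
Proof.
move: P; apply: (@eq_semilin _ _ sc) => [c P Q||m].
- by rewrite wfun_semilin twactDr twactZ.
- by apply: semilin_suml => k; apply: semilinM; apply: wfun_semilin.
rewrite -tprodX wfun_tprod /wact wmoore_unitw psi_T_moore.
apply: eq_bigr => k _; rewrite -atX_X atX_tprod wfun_tprod /wact wmoore_rowk.
rewrite updf_id actM; congr (_ * _); apply: eq_moore_cof => i ne.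
by rewrite updf_neq.
Qed.

Section Torsion.
Variables (beta : 'I_r.+1 -> L) (c : {poly Fq}).
Hypothesis beta_tors : forall k, act c (beta k) = 0.
Local Notation H := (chain r c r).

(** The difference of two consecutive variables turns the link joining them into a difference of
    values of [c], and both values are annihilated by torsion. *)
Lemma wfun_chainX w (k : 'I_r.+1) Q :
  wfun w beta ('X_k * (H * Q)) = wfun w beta ('X_ord0 * (H * Q)).
Proof.
rewrite -[k]inord_val; elim: (k : nat) (ltn_ord k) => [|t IHt] lt_tr.
  by congr (wfun w beta ('X__ * _)); apply: val_inj; rewrite /= inordK.
rewrite -IHt ?(ltnW lt_tr) //; apply/esym/eqP; rewrite -subr_eq0.
rewrite -(semilinB _ _ (wfun_semilin w beta)) -mulrBl mulrA.
rewrite ltnS in lt_tr; rewrite /chain (bigD1 (Ordinal lt_tr)) //= mulrA divdiffE.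
rewrite !mulrBl (semilinB _ _ (wfun_semilin w beta)) -!mulrA.
by rewrite !wfun_annihil // subrr.
Qed.

(** Horner induction on [b]; [Q] is left general because each step absorbs one factor ['X_ord0] into
    it. *)
Lemma psi_wfun_chain b Q :
  twact emb (psi b) (wfun unitw beta (H * Q))
  = wfun unitw beta (atX ord0 b * (H * Q)).
Proof.
elim/poly_ind: b Q => [|b d IHb] Q.
  rewrite rmorph0 atX0 mul0r (semilin0 (wfun_semilin _ _)).
  by rewrite (@twactE _ _ _ _ _ 0) ?big_ord0 // /skewsize size_poly0.
rewrite rmorphD rmorphM psiC twactDl twactM twactC psi_T_wfun.
under eq_bigr do rewrite wfun_chainX.
rewrite wfun_rowk_sum mulrCA IHb atXD atXM atX_X atXC mulrDl.
rewrite (semilinD _ _ (wfun_semilin _ _)) -scalerAl mul1r.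
rewrite (semilinZ _ _ (wfun_semilin _ _)); congr (wfun _ _ _ + _).
by rewrite [H * (_ * _)]mulrCA -[RHS]mulrA.
Qed.

End Torsion.

Lemma wfun_chainM w beta a b : (forall k, act (a * b) (beta k) = 0) ->
  wfun w beta (atX ord0 b * chain r (a * b) r)
  = wfun w beta (tprod (fun=> b) * chain r a r).
Proof.
move=> beta_tors.
(* The links are converted one at a time; [Q] holds those already detached from the end of the
   chain. *)
suff main n Q : (n <= r)%N -> wfun w beta (atX ord0 b * chain r (a * b) n * Q)
    = wfun w beta ((\prod_(t < n.+1) atX (inord t) b) * chain r a n * Q).
  have := main r 1 (leqnn r); rewrite !mulr1 => ->.
  by congr (wfun w beta (_ * _)); apply: eq_bigr => t _; rewrite inord_val.
elim: n Q => [|n IHn] Q le_nr.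
  rewrite big_ord1 /chain !big_ord0 (_ : inord (ord0 : 'I_1) = ord0) //.
  by apply: val_inj; rewrite /= inordK.
rewrite !chainS mulrA -mulrA IHn 1?ltnW //.
(* In the product rule, the term with [a('X_n)] meets the factor [b('X_n)] already present and dies
   by torsion; the other supplies [b('X_(n+1))] and the next link for [a]. *)
rewrite divdiffM ?(inord_neqS (Ordinal le_nr)) //.
rewrite mulrDl mulrDr (semilinD _ _ (wfun_semilin _ _)).
rewrite [X in X + _](_ : _ = 0) ?add0r.
  by rewrite [in RHS]big_ord_recr /=; congr (wfun w beta _); ring.
rewrite big_ord_recr /=; set u := \prod_(t < n) _; set v := chain _ _ _.
rewrite (_ : _ * _ = atX (inord n) (a * b) * (u * v * divdiff b (inord n) (inord n.+1) * Q)).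
  exact: wfun_annihil.
by rewrite atXM; ring.
Qed.

End MooreFunctional.

(** * The map [W_a] as a value of the functional, and the conclusion *)

(** The definition of [weil] evaluates the functional on the normal form of the chain; on torsion
    points [wfun_nf] removes the reduction. *)
Lemma weil_wfun (Fq : finFieldType) (E : closedFieldType)
    (jota : {rmorphism Fq -> E}) (K : fieldType) (iota : {rmorphism Fq -> K})
    (L : fieldType) (emb : {rmorphism K -> L}) (r : nat)
    (phi : {rmorphism {poly Fq} -> twpoly iota})
    (phiC : forall c : Fq, phi c%:P = skewC (frob iota) (iota c))
    (a : {poly Fq}) (beta : 'I_r.+1 -> L) :
  a \is monic -> (1 <= (size a).-1)%N ->
  (forall k, twact emb (phi a) (beta k) = 0) ->
  weil jota emb phi a beta = wfun emb phi (@unitw L r) beta (chain r a r).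
Proof.
move=> a_monic a_deg beta_tors; rewrite -(wfun_nf phiC _ _ beta_tors).
rewrite nf_expand ?monic_neq0 // (semilin_sum _ _ _ (wfun_semilin _ _ _ _)).
apply: eq_bigr => i _; rewrite (semilinZ _ _ (wfun_semilin _ _ _ _)) fcoef_nf //.
congr (_ * _); rewrite -tprodX wfun_tprod // /wact wmoore_unitw.
by congr (\det _); apply/matrixP => k j; rewrite !mxE mnmE.
Qed.

Theorem theorem4p2
  (Fq : finFieldType)
  (Fqbar : closedFieldType) (jota : {rmorphism Fq -> Fqbar})
  (Fqbar_closure : algebraic_closure jota)
  (K : fieldType) (iota : {rmorphism Fq -> K})
  (gamma : {rmorphism {poly Fq} -> K})
  (gamma_alg : forall c : Fq, gamma c%:P = iota c)
  (Kbar : closedFieldType) (emb : {rmorphism K -> Kbar})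
  (Kbar_closure : algebraic_closure emb)
  (r : nat) (r_ge1 : (1 <= r)%N)
  (phi : {rmorphism {poly Fq} -> twpoly iota})
  (phi_drinfeld : drinfeld_module gamma r phi)
  (psi : {rmorphism {poly Fq} -> twpoly iota})
  (psi_drinfeld : drinfeld_module gamma 1 psi)
  (psi_T : psi 'X = skewC (frob iota) (gamma 'X)
     + skewC (frob iota) ((-1) ^+ r.-1 * skewcoef (phi 'X) r) * skewX (frob iota))
  (a b : {poly Fq})
  (a_monic : a \is monic) (a_deg : (1 <= (size a).-1)%N)
  (b_monic : b \is monic) (b_deg : (1 <= (size b).-1)%N)
  (beta : 'I_r -> Kbar)
  (beta_tors : forall k, beta k \in torsion emb phi (a * b)) :
  twact emb (psi b) (weil jota emb phi (a * b) beta)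
  = weil jota emb phi a (fun k => twact emb (phi b) (beta k)).
Proof.
case: r r_ge1 phi_drinfeld psi_T beta beta_tors => // s _ [_ phiC phiT] psi_T beta.
move=> beta_tors; have [_ psiC _] := psi_drinfeld.
have [phiT0 phiTsize] := phiT 'X (negbT (polyX_eq0 _)).
rewrite size_polyX muln1 in phiTsize.
have ab_tors k : twact emb (phi (a * b)) (beta k) = 0 by apply/eqP/beta_tors.
(* Needed to apply [weil_wfun] to the right-hand side, at the points [phi_b(beta_k)]. *)
have a_tors k : twact emb (phi a) (twact emb (phi b) (beta k)) = 0.
  by rewrite -twactM -rmorphM.
have ab_deg : (1 <= (size (a * b)%R).-1)%N.
  rewrite size_monicM ?monic_neq0 //; move: a_deg b_deg.
  by case: (size a) => // m; case: (size b) => // n; rewrite addSn addnS /= addn_gt0 => ->.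
(* The factor 1 plays the role of [Q] in [psi_wfun_chain]. *)
rewrite !weil_wfun ?monicMl // -[chain s (a * b) s]mulr1.
rewrite (psi_wfun_chain phiC psiC psi_T phiT0 erefl phiTsize ab_tors) mulr1.
by rewrite wfun_chainM // wfun_tprodM.
Qed.
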